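(* Let $q$ be a prime power, $n$ a positive integer, $L(x)=\sum_{i=0}^{n-1}a_ix^{q^{2i}}$ with $a_i\in\mathbb F_{q^{2n}}$, and suppose $L$ has degree $q^{2m}$ for some nonnegative integer $m$. For $c\in\mathbb F_{q^2}$ let $N_c$ be the number of $u\in\mathbb F_{q^{2n}}$ with $\mathrm{Tr}(uL(u^q))+c=0$. Then $|N_c-q^{2(n-1)}|\le(q^2-1)q^{n+2m-1}$, and equality holds if and only if $c=0$ and $\dim\ker(\upsilon L^*+L)=2m+1$ for every $\upsilon\in U$. In this case $N_0-q^{2(n-1)}=(-1)^{n-1}(q^2-1)q^{n+2m-1}$.
   Context: $\mathrm{Tr}$ is the trace $\mathbb F_{q^{2n}}\to\mathbb F_{q^2}$. $L^*(x)=\sum_{i=0}^{n-1}(a_i^qx)^{q^{2(n-i-1)}}$. $U$ is the subgroup of order $q+1$ of $\mathbb F_{q^2}^*$. Kernels are those of the induced $\mathbb F_{q^2}$-linear maps on $\mathbb F_{q^{2n}}$, dimensions over $\mathbb F_{q^2}$. *)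

(* Defs.v *)
From HB Require Import structures.
From mathcomp Require Import all_boot all_order all_algebra all_field.
Set Implicit Arguments. Unset Strict Implicit. Unset Printing Implicit Defensive.
Import GRing.Theory.
Local Open Scope ring_scope.

(* F0 plays the role of F_{q^2}; E : fieldExtType F0 of dimension n plays
   the role of F_{q^{2n}} (so E is an F_{q^2}-vector space). *)

Definition prime_power (q : nat) : Prop :=
  exists p k : nat, prime p /\ (0 < k)%N /\ q = (p ^ k)%N.

Definition Tr {F0 : fieldType} {E : fieldExtType F0} (q n : nat) (x : E) : E :=
  \sum_(i < n) x ^+ (q ^ (2 * i)).

Definition Lpol {F0 : fieldType} {E : fieldExtType F0} (q n : nat)
  (a : nat -> E) (x : E) : E :=
  \sum_(i < n) a i * x ^+ (q ^ (2 * i)).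

Definition Lstar {F0 : fieldType} {E : fieldExtType F0} (q n : nat)
  (a : nat -> E) (x : E) : E :=
  \sum_(i < n) (a i ^+ q * x) ^+ (q ^ (2 * (n - i - 1))).

(* U: the subgroup of order q+1 of F_{q^2}^* *)
Definition inU {F0 : fieldType} (q : nat) (v : F0) : bool := v ^+ q.+1 == 1.

Definition Ncount {F0 : finFieldType} {E : fieldExtType F0} (q n : nat)
  (a : nat -> E) (c : F0) : nat :=
  #|[set u : finvect_type E |
      Tr q n ((u : E) * Lpol q n a ((u : E) ^+ q)) + c%:A == 0]|.

Definition vLstarL {F0 : fieldType} {E : fieldExtType F0} (q n : nat)
  (a : nat -> E) (v : F0) : 'End(E) :=
  linfun (fun x : E => v *: Lstar q n a x + Lpol q n a x).

(* Main.v *)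
(* For l in F_{q^2}^*, H_l(x, y) = l Tr(x L(y^q)) + (l Tr(y L(x^q)))^q is a
   Hermitian form whose radical corresponds, under y |-> y^q, to the kernel of
   l^(q-1) L^* + L; let d_l be its dimension. If Z_s counts the u with
   H_l(u, u) = s, then Z_s is the same for all s <> 0 in F_q, and the excess
   S_l = Z_0 - Z_1 is (-1)^(n+d_l) q^(n+d_l): counting the pairs (u, v) by
   H_l(u, u) - H_l(v, v) gives S_l^2 = q^(2n+2d_l), and the sign follows from
   S_l = 1 modulo q + 1, since the group U acts freely on nonzero vectors.
   Detecting w = 0 by the number of l with T(l w) = 0, where T(x) = x + x^q,
   yields q^2 (q-1) (N_c - q^(2n-2)) = sum_l S_l (q [T(l c) = 0] - 1), and
   d_l <= 2m+1 because a Frobenius twist of l^(q-1) L^* + L has degree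
   q^(2(2m+1)) modulo x^(q^(2n)) - x. In the extremal case all d_l are equal,
   so S_l is constant, and the remaining sum is maximal only for c = 0. *)

Require Import Defs.
From HB Require Import structures.
From mathcomp Require Import all_boot all_order all_algebra all_field.
From mathcomp Require Import zify ring.
Import Order.TTheory GRing.Theory Num.Theory.
Local Open Scope ring_scope.

(** * Fibres of power maps on a finite field *)

Lemma card_root_ltn (K : finFieldType) (p : {poly K}) :
  p != 0 -> (#|[set x | root p x]| < size p)%N.
Proof.
move=> p0; rewrite cardE; apply: max_poly_roots => //; last exact: enum_uniq.
by apply/allP => x; rewrite mem_enum inE.
Qed.

Lemma card_expr_eq_leq (K : finFieldType) (a : nat) (y : K) :
  (0 < a)%N -> (#|[set x | x ^+ a == y]| <= a)%N.
Proof.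
move=> a0; have sz := size_XnsubC y a0; rewrite -ltnS -sz.
have -> : [set x | x ^+ a == y] = [set x | root ('X^a - y%:P) x].
  by apply/setP => x; rewrite !inE rootE !hornerE subr_eq0.
by apply: card_root_ltn; rewrite -size_poly_gt0 sz.
Qed.

(* The fibres of x |-> x ^+ a over the b-th roots of unity have at most a
   elements, there are at most b of them, and they cover all a * b nonzero
   elements. *)
Lemma card_expr_eq (K : finFieldType) (a b : nat) (y : K) :
  #|K| = (a * b).+1 -> y ^+ b = 1 -> #|[set x | x ^+ a == y]| = a.
Proof.
move=> cK yb.
have ab0 : (0 < a * b)%N by have := finNzRing_gt1 K; rewrite cK.
have [a0 b0] : (0 < a)%N /\ (0 < b)%N by apply/andP; rewrite -muln_gt0.
apply/eqP; rewrite eqn_leq card_expr_eq_leq //=.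
pose N z := #|[set x : K | x ^+ a == z]|.
have sumN : \sum_(z : K | z ^+ b == 1) N z = (a * b)%N.
  have -> : (a * b)%N = #|[pred x : K | x != 0]| by rewrite (cardC1 (0 : K)) cK.
  rewrite -sum1_card [RHS](partition_big (fun x => x ^+ a) (fun z => z ^+ b == 1)).
    apply: eq_bigr => z /eqP zb; rewrite /N -sum1_card; apply: eq_bigl => x.
    rewrite !inE; have [xa|] := eqVneq (x ^+ a) z; last by rewrite andbF.
    rewrite andbT; apply/esym; apply: contraTneq isT => x0.
    by move: zb; rewrite -xa x0 expr0n gtn_eqF //= expr0n gtn_eqF // => /eqP;
      rewrite eq_sym oner_eq0.
  move=> x /= x0; rewrite -exprM -(inj_eq (mulIf x0)) mul1r -exprSr -cK.
  by rewrite expf_card.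
have := sumN; rewrite (bigD1 y) /=; last by rewrite yb.
have le : (\sum_(z : K | (z ^+ b == 1%R) && (z != y)) N z <= b.-1 * a)%N.
  rewrite (leq_trans (n := \sum_(z : K | (z ^+ b == 1%R) && (z != y)) a)) //.
    by apply: leq_sum => z _; apply: card_expr_eq_leq.
  rewrite sum_nat_const leq_mul2r; apply/orP; right.
  have := card_expr_eq_leq K b 1 b0; rewrite (cardsD1 y) inE yb eqxx add1n.
  rewrite -[b in (_ <= b)%N](prednK b0) ltnS; apply: leq_trans.
  by apply: eq_leq; apply: eq_card => z; rewrite !inE andbC.
by move=> e; rewrite -/(N y) -(leq_add2r (b.-1 * a)%N) -mulSn prednK // mulnC -e leq_add2l.
Qed.

(** * Norm and trace from a field with q^2 elements to its subfield with q elements *)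

Section QuadraticExtension.

Variables (K : finFieldType) (q : nat).
Hypotheses (cK : #|K| = (q ^ 2)%N) (q1 : (1 < q)%N).

Let cK1 : #|K| = (q.-1 * q.+1).+1. Proof. by rewrite cK; nia. Qed.
Let cK2 : #|K| = (q.+1 * q.-1).+1. Proof. by rewrite cK; nia. Qed.

Lemma expr_fix (s : K) : (s ^+ q == s) = (s == 0) || (s ^+ q.-1 == 1).
Proof.
rewrite -subr_eq0 -{1}(prednK (ltnW q1)) exprSr -[X in _ - X]mul1r -mulrBl.
by rewrite mulf_eq0 subr_eq0 orbC.
Qed.

Lemma card_fix : #|[set s : K | s ^+ q == s]| = q.
Proof.
rewrite (cardsD1 0) inE expr_fix eqxx /=.
rewrite -[in RHS](prednK (ltnW q1)) add1n; congr _.+1.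
rewrite -(@card_expr_eq K q.-1 q.+1 1 cK1 (expr1n _ _)).
apply: eq_card => s; rewrite !inE expr_fix.
case: eqP => //= ->; rewrite expr0n eq_sym gtn_eqF; last by lia.
by rewrite oner_eq0.
Qed.

(** A nonzero fixed [s] is a (q-1)-th root of unity, so its fibre under x^(q+1) has q+1 elements. *)
Lemma norm_surj (s : K) : s != 0 -> s ^+ q = s -> exists x, x ^+ q.+1 = s.
Proof.
move=> s0 /eqP; rewrite expr_fix (negPf s0) /= => /eqP s1.
have := @card_expr_eq K q.+1 q.-1 s cK2 s1.
case: (set_0Vmem [set x | x ^+ q.+1 == s]) => [->|[x]]; first by rewrite cards0.
by rewrite inE => /eqP; exists x.
Qed.

Lemma hilbert90 (v : K) : v ^+ q.+1 = 1 -> exists x, x != 0 /\ x ^+ q.-1 = v.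
Proof.
move=> v1; have := @card_expr_eq K q.-1 q.+1 v cK1 v1.
case: (set_0Vmem [set x | x ^+ q.-1 == v]) => [->|[x]]; first by rewrite cards0; lia.
rewrite inE => /eqP xv _; exists x; split => //; apply: contra_eq_neq v1 => x0.
by rewrite -xv x0 expr0n gtn_eqF ?expr0n /= 1?eq_sym ?oner_eq0 //; lia.
Qed.

(** Turns a condition over U into one over the nonzero l that index the forms H_l; the power map
    x^(q-1) sends these l onto U. *)
Lemma unitary_forall (P : K -> Prop) :
  (forall v, inU q v -> P v) <-> (forall l, l != 0 -> P (l ^+ q.-1)).
Proof.
split=> [PU l l0 | Pl v /eqP vU]; last by have [l [/Pl ? <-]] := hilbert90 v vU.
apply: PU; rewrite /inU -exprM -(inj_eq (mulIf l0)) mul1r -exprSr.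
by rewrite -cK1 expf_card.
Qed.

(** For y = l c nonzero, y + y^q = 0 means y^(q-1) = -1, and -1 is itself a (q+1)-th root of
    unity. *)
Lemma card_trace0 (c : K) : c != 0 ->
  #|[set l : K | (l != 0) && (l * c + (l * c) ^+ q == 0)]| = q.-1.
Proof.
move=> c0.
(* For even q the relation (-1)^(q^2) = -1 reads 1 = -1; for odd q the exponent q+1 is even. *)
have odd1 : (-1) ^+ q.+1 = 1 :> K.
  have := expf_card (-1 : K); rewrite cK -mulnn exprM exprS -signr_odd.
  case: (odd q) => /=; first by rewrite expr1 mulN1r opprK.
  by rewrite expr0 expr1n mulr1 => <-.
rewrite -[RHS](@card_expr_eq K q.-1 q.+1 (-1) cK1 odd1).
rewrite -(card_imset _ (mulIf c0)).
apply: eq_card => x; apply/imsetP/idP => [[l]|].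
  rewrite !inE => /andP[l0]; set y := l * c.
  have y0 : y != 0 by rewrite mulf_neq0.
  rewrite -[in y ^+ q](prednK (ltnW q1)) exprSr -[X in X + _]mul1r -mulrDl mulf_eq0.
  by rewrite (negPf y0) orbF addrC addr_eq0 => ? ->.
rewrite inE => /eqP xv; exists (x / c); last by rewrite divfK.
have x0 : x != 0.
  apply: contra_eq_neq xv => ->; rewrite expr0n gtn_eqF; last by lia.
  by rewrite eq_sym oppr_eq0 oner_eq0.
rewrite inE divfK // mulf_neq0 ?invr_eq0 //=.
by rewrite -[in x ^+ q](prednK (ltnW q1)) exprSr xv mulN1r subrr.
Qed.

Hypothesis pcharq : [pchar K].-nat q.

Lemma exprqD (x y : K) : (x + y) ^+ q = x ^+ q + y ^+ q.
Proof. exact: exprDn_pchar. Qed.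

Lemma exprqN (x : K) : (- x) ^+ q = - x ^+ q.
Proof.
by apply/esym/eqP; rewrite eq_sym -addr_eq0 -exprqD addNr expr0n gtn_eqF // ltnW.
Qed.

Lemma exprqq (x : K) : x ^+ q ^+ q = x.
Proof. by rewrite -exprM mulnn -cK expf_card. Qed.

(** The trace has only q-1 nonzero zeros among q^2-1 elements. A nonzero value of it lies in the
    subfield, so dividing by that value normalises the trace to 1. *)
Lemma trace_surj : exists x : K, x + x ^+ q = 1.
Proof.
have [x /andP[x0 xT]] : exists x : K, (x != 0) && (x + x ^+ q != 0).
  apply/existsP; apply: contraT; rewrite negb_exists => /forallP all0.
  have := card_trace0 1 (oner_neq0 _).
  have -> : #|[set l : K | (l != 0) && (l * 1 + (l * 1) ^+ q == 0)]| = #|K|.-1.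
    rewrite -(cardC1 (0 : K)); apply: eq_card => l; rewrite !inE mulr1.
    by have := all0 l; case: eqVneq => //= _; rewrite negbK.
  by rewrite cK; nia.
exists (x / (x + x ^+ q)).
by rewrite expr_div_n exprqD exprqq [x ^+ q + x]addrC -mulrDl divff.
Qed.

Lemma sum_delta_fix (t : K) : t ^+ q = t ->
  \sum_(s : K | s ^+ q == s) (s == t)%:R = 1 :> int.
Proof.
move=> tq; rewrite (bigD1 t) /=; last by rewrite tq.
by rewrite eqxx big1 ?addr0 // => s /andP[_ /negPf->].
Qed.

(** * Hermitian forms over a finite field: level sets and radical *)

Section HermitianForm.

Variables (V : finLmodType K) (H : V -> V -> K).
Hypotheses (HD : forall x y z, H (x + y) z = H x z + H y z)
  (HZ : forall k x z, H (k *: x) z = k * H x z)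
  (HC : forall x y, H y x = H x y ^+ q).

Local Notation h u := (H u u).

Definition herm_count (s : K) : nat := #|[set u : V | h u == s]|.
(* Equals the sum of psi (H u u) over u, for any nontrivial additive character
   psi of the subfield of order q. *)
Definition herm_excess : int := (herm_count 0)%:Z - (herm_count 1)%:Z.
Definition herm_rad : {set V} := [set w | [forall v, H v w == 0]].

Local Notation Z := herm_count.
Local Notation S := herm_excess.

Lemma herm_fix u : h u ^+ q = h u.
Proof. by rewrite -HC. Qed.

Lemma herm_scale k u : h (k *: u) = k ^+ q.+1 * h u.
Proof. by rewrite HZ [H u _]HC HZ exprMn herm_fix mulrA -exprS. Qed.

Lemma herm0 : h 0 = 0.
Proof. by rewrite -(scale0r (0 : V)) HZ mul0r. Qed.

Lemma herm_add v w : h (v + w) = h v + h w + (H v w + H v w ^+ q).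
Proof.
by rewrite HD !(HC (v + w)) !HD !exprqD -!HC; ring.
Qed.

(** A scalar of norm s maps the level set of 1 bijectively onto that of s. *)
Lemma herm_count_neq0 s : s ^+ q = s -> s != 0 -> Z s = Z 1.
Proof.
move=> sq s0; have [k ks] := norm_surj s s0 sq.
have k0 : k != 0 by apply: contra_neq s0 => k0; rewrite -ks k0 expr0n.
rewrite /herm_count -[RHS](card_imset _ (scalerI k0)); apply: eq_card => u.
apply/idP/imsetP => [|[v]]; rewrite !inE.
  move=> /eqP hu; exists (k^-1 *: u); last by rewrite scalerA divff ?scale1r.
  by rewrite inE herm_scale hu exprVn ks mulVf.
by move=> /eqP hv ->; rewrite herm_scale hv mulr1 ks.
Qed.

Lemma herm_countE s : s ^+ q = s -> (Z s)%:Z = (Z 1)%:Z + S * (s == 0)%:R.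
Proof.
move=> sq; have [->|s0] := eqVneq s 0; first by rewrite mulr1 addrC subrK.
by rewrite mulr0 addr0 herm_count_neq0.
Qed.

(** When [f] sums to zero over the subfield, only [S * f 0] survives; for constant [f] the formula
    counts [V]. *)
Lemma herm_sum (f : K -> int) :
  \sum_u f (h u) = (Z 1)%:Z * (\sum_(s | s ^+ q == s) f s) + S * f 0.
Proof.
rewrite (partition_big (fun u => h u) (fun s => s ^+ q == s)) /=; last first.
  by move=> u _; rewrite herm_fix.
have q0 : (0 : K) ^+ q = 0 by rewrite expr0n gtn_eqF // ltnW.
transitivity (\sum_(s : K | s ^+ q == s) ((Z 1)%:Z * f s + S * (f s * (s == 0)%:R))).
  apply: eq_bigr => s /eqP sq.
  transitivity (\sum_(u in [set u | h u == s]) f s).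
    by rewrite big_set; apply: eq_bigr => u /eqP ->.
  rewrite sumr_const -/(herm_count s) pmulrn -mulrzl intz herm_countE //; ring.
rewrite big_split /= -!mulr_sumr; congr (_ + S * _).
rewrite (bigD1 0) /=; last by rewrite q0.
by rewrite eqxx mulr1 big1 ?addr0 // => s /andP[_ /negPf->]; rewrite mulr0.
Qed.

Lemma card_herm : (#|V|)%:Z = (Z 1)%:Z * q%:Z + S.
Proof.
have := herm_sum (fun=> 1); rewrite !sumr_const mulr1 !natz => ->.
have e : #|[set s : K | s ^+ q == s]| = q by exact: card_fix.
by rewrite -[in RHS]e cardsE.
Qed.

(** An integer-valued substitute for an additive character: it and its reflected translates sum to
    zero over the subfield, and it is 1 at 0. *)
Let rho (s : K) : int := (s == 0)%:R - (s == 1)%:R.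

Let rho_sum t : t ^+ q = t -> \sum_(s | s ^+ q == s) rho (t - s) = 0.
Proof.
move=> tq; rewrite /rho sumrB.
under eq_bigr do rewrite subr_eq0 eq_sym.
under [X in _ - X]eq_bigr => s _.
  have -> : (t - s == 1) = (s == t - 1) by rewrite subr_eq addrC -subr_eq eq_sym.
  over.
by rewrite !sum_delta_fix ?subrr // exprqD exprqN tq expr1n.
Qed.

Let rhoN_sum : \sum_(s | s ^+ q == s) rho s = 0.
Proof.
by rewrite /rho sumrB !sum_delta_fix ?subrr ?expr1n // expr0n gtn_eqF // ltnW.
Qed.

Let rho0 : rho 0 = 1. Proof. by rewrite /rho eqxx eq_sym oner_eq0. Qed.

(* Both sides count the pairs (u, v), with weight 1 if h u - h v = 0 and -1 if
   h u - h v = 1: the left-hand side by the values of h, the right-hand side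
   by the differences w = u - v, only the radical contributing. *)
Lemma herm_excess_sqr : S ^+ 2 = (#|V| * #|herm_rad|)%N%:Z.
Proof.
have <- : \sum_u \sum_v rho (h u - h v) = S ^+ 2.
  under eq_bigr => u _ do
    rewrite (herm_sum (fun s => rho (h u - s))) rho_sum ?herm_fix // mulr0 add0r subr0.
  by rewrite -mulr_sumr herm_sum rhoN_sum mulr0 add0r rho0 mulr1.
rewrite exchange_big /=.
under eq_bigr => v _.
  rewrite (reindex_inj (addrI v)) /=.
  under eq_bigr => w _.
    have -> : h (v + w) - h v = h w + (H v w + H v w ^+ q).
      by rewrite herm_add; ring.
    over.
  over.
rewrite exchange_big /= (bigID (mem herm_rad)) /= [X in _ + X]big1 ?addr0.
  rewrite (eq_bigr (fun=> #|V|%:Z)); first by rewrite sumr_const -mulr_natr natz.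
  move=> w; rewrite inE => /forallP Hw.
  rewrite (eq_bigr (fun=> 1)); first by rewrite sumr_const natz.
  by move=> v _; rewrite !(eqP (Hw _)) expr0n gtn_eqF ?(ltnW q1) // !addr0 rho0.
move=> w; rewrite inE negb_forall => /existsP[v0 Hv0].
have [x xT] := trace_surj.
(* The scaling gives [H v1 w = x], of trace 1. Translating v by [v1] therefore carries the vectors
   counted for the value 0 to those counted for the value 1, and the two counts cancel. *)
pose v1 := (x / H v0 w) *: v0.
rewrite /rho sumrB; apply/eqP; rewrite subr_eq0; apply/eqP.
rewrite [RHS](reindex_inj (addIr v1)) /=; apply: eq_bigr => v _.
have Hv1 : H v1 w = x by rewrite HZ divfK.
rewrite HD Hv1 exprqD; set a := h w; set b := H v w.
have -> : a + (b + x + (b ^+ q + x ^+ q)) = (a + (b + b ^+ q)) + (x + x ^+ q) by ring.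
by rewrite xT -[X in _ = (_ == X)%:R]add0r (inj_eq (addIr 1)).
Qed.

(** Scalars of norm 1 act freely on nonzero vectors, so [A] is a disjoint union of orbits of size
    q+1. *)
Lemma dvdn_unitary_stable (A : {set V}) : 0 \notin A ->
  (forall z u, z ^+ q.+1 = 1 -> u \in A -> z *: u \in A) -> (q.+1 %| #|A|)%N.
Proof.
move=> A0 Astable.
pose U := [set z : K | z ^+ q.+1 == 1].
have cU : #|U| = q.+1 by apply: (@card_expr_eq K q.+1 q.-1 1 cK2); rewrite expr1n.
pose orb (u : V) := [set z *: u | z in U].
rewrite -sum1_card (partition_big_imset orb) /=; apply: dvdn_sum => X.
case/imsetP => u uA ->; rewrite sum1_card.
have u0 : u != 0 by apply: contraNneq A0 => <-.
suff -> : #|[pred v | (v \in A) && (orb v == orb u)]| = q.+1 by [].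
rewrite -cU -(@card_in_imset _ _ (fun z => z *: u) U); last first.
  move=> z z' _ _ /eqP; rewrite -subr_eq0 -scalerBl scaler_eq0 (negPf u0) orbF.
  by rewrite subr_eq0 => /eqP.
apply: eq_card => v; rewrite !inE; apply/andP/imsetP => [[vA /eqP ov]|].
  have : v \in orb v by apply/imsetP; exists 1; rewrite ?scale1r // inE expr1n.
  by rewrite ov => /imsetP.
case=> z; rewrite inE => /eqP zU ->; split; first exact: Astable.
have z0 : z != 0 by apply: contra_eq_neq zU => ->; rewrite expr0n eq_sym oner_eq0.
apply/eqP/setP => w; apply/imsetP/imsetP => -[t tU ->].
  exists (t * z); last by rewrite scalerA.
  by move: tU; rewrite !inE exprMn zU => /eqP ->; rewrite mulr1.
exists (t / z); last by rewrite scalerA divfK.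
by move: tU; rewrite !inE exprMn exprVn zU => /eqP ->; rewrite invr1 mulr1.
Qed.

(** Scalars of norm 1 preserve the level sets; the zero vector, in level 0, accounts for the 1. *)
Lemma herm_excess_mod : (q.+1%:Z %| S - 1)%Z.
Proof.
have st s : (forall z u, z ^+ q.+1 = 1 -> h u == s -> h (z *: u) == s).
  by move=> z u zU; rewrite herm_scale zU mul1r.
have d1 : (q.+1 %| Z 1%R)%N.
  apply: dvdn_unitary_stable; first by rewrite inE herm0 eq_sym oner_eq0.
  by move=> z u zU; rewrite !inE; apply: st.
have d0 : (q.+1 %| (Z 0%R).-1)%N.
  have -> : (Z 0).-1 = #|[set u : V | h u == 0%R] :\ 0%R|.
    by rewrite /herm_count (cardsD1 0) inE herm0 eqxx.
  apply: dvdn_unitary_stable; first by rewrite !inE eqxx.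
  move=> z u zU; rewrite !inE => /andP[u0 hu]; rewrite st // andbT.
  rewrite scaler_eq0 negb_or u0 andbT.
  by apply: contra_eq_neq zU => ->; rewrite expr0n eq_sym oner_eq0.
have Z0 : (0 < Z 0%R)%N by rewrite /herm_count (cardsD1 0) inE herm0 eqxx.
have -> : S - 1 = (Z 0).-1%:Z - (Z 1)%:Z by rewrite /herm_excess; lia.
by rewrite rpredB.
Qed.

Lemma herm_excessE (n d : nat) : #|V| = (q ^ (2 * n))%N ->
  #|herm_rad| = (q ^ (2 * d))%N -> S = (-1) ^+ (n + d) * (q ^ (n + d))%N%:Z.
Proof.
move=> cV cR.
have : S ^+ 2 = (q ^ (n + d))%N%:Z ^+ 2.
  by rewrite herm_excess_sqr cV cR -expnD -mulnDr mulnC expnM -!natz natrX.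
(* Modulo q+1 one has q = -1, so (-q)^(n+d) = 1. *)
have qmod : (q.+1%:Z %| (-1) ^+ (n + d) * (q ^ (n + d))%N%:Z - 1)%Z.
  elim: (n + d)%N => [|k IH]; first by rewrite mul1r subrr dvdz0.
  have -> : (-1) ^+ k.+1 * (q ^ k.+1)%N%:Z - 1 =
    ((-1) ^+ k * (q ^ k)%N%:Z - 1) - ((-1) ^+ k * (q ^ k)%N%:Z) * q.+1%:Z :> int.
    by rewrite exprS expnS -addn1 !PoszM PoszD; ring.
  by rewrite rpredB // dvdz_mull.
move/eqP; rewrite eqf_sqr; have e1 : (-1) ^+ (n + d) = 1 :> int \/ (-1) ^+ (n + d) = -1 :> int.
  by apply/pred2P; rewrite /= -sqrf_eq1 sqrr_sign.
have := herm_excess_mod; move: qmod; set Q := (q ^ _)%N%:Z => qmod Smod.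
suff : S != - ((-1) ^+ (n + d) * Q).
  by case: e1 => ->; rewrite ?mul1r ?mulN1r ?opprK => /negPf -> ; rewrite ?orbF //= => /eqP.
(* With the opposite sign, adding the two congruences makes q+1 divide 2, whereas q+1 is at least
   3. *)
apply: contraTneq qmod => SE; apply/negP => qmod.
have : (q.+1%:Z %| (S - 1) + ((-1) ^+ (n + d) * Q - 1))%Z by rewrite rpredD.
have -> : S - 1 + ((-1) ^+ (n + d) * Q - 1) = -2 by rewrite SE; ring.
by rewrite dvdzE /= => /dvdn_leq; lia.
Qed.

End HermitianForm.

End QuadraticExtension.

(** * The trace of the extension of degree n and its nondegeneracy *)

Section TraceForm.

Variables (K : finFieldType) (q n : nat) (E : fieldExtType K).
Hypotheses (cK : #|K| = (q ^ 2)%N) (q1 : (1 < q)%N) (pcharq : [pchar K].-nat q)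
  (dimE : \dim {:E} = n) (n0 : (0 < n)%N).
Local Notation W := (finvect_type E).
Local Notation Tr := (@Tr K E q n).

Let q0 : (0 < q)%N. Proof. exact: ltnW. Qed.

Lemma card_ext : #|{: W}| = (q ^ (2 * n))%N.
Proof.
rewrite -(@card_vspacef K W (Vector.class (W : vectType K))) card_vspace cK -expnM.
by congr (_ ^ (2 * _))%N.
Qed.

Lemma expr_card_ext (x : E) : x ^+ (q ^ (2 * n)) = x.
Proof. by rewrite -card_ext; apply: (expf_card (x : W)). Qed.

Lemma expr_pow_base (k : K) i : k ^+ (q ^ (2 * i)) = k.
Proof.
rewrite expnM -cK; elim: i => [|i IH]; first by rewrite expr1.
by rewrite expnSr exprM IH expf_card.
Qed.

Lemma exprqkD i (x y : E) : (x + y) ^+ (q ^ i) = x ^+ (q ^ i) + y ^+ (q ^ i).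
Proof.
apply: exprDn_pchar; rewrite pnatX; apply/orP; left.
by rewrite (eq_pnat _ (pchar_lalg E)).
Qed.

Lemma exprqk_sum I (r : seq I) (P : pred I) (f : I -> E) i :
  (\sum_(j <- r | P j) f j) ^+ (q ^ i) = \sum_(j <- r | P j) f j ^+ (q ^ i).
Proof.
apply: (big_morph (fun x : E => x ^+ (q ^ i))) => [x y|]; first exact: exprqkD.
by rewrite expr0n gtn_eqF // expn_gt0 q0.
Qed.

Lemma exprq_sum I (r : seq I) (P : pred I) (f : I -> E) :
  (\sum_(j <- r | P j) f j) ^+ q = \sum_(j <- r | P j) f j ^+ q.
Proof. by have := exprqk_sum I r P f 1; rewrite expn1. Qed.

Lemma exprqkZ (k : K) (x : E) i :
  (k *: x) ^+ (q ^ (2 * i)) = k *: x ^+ (q ^ (2 * i)).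
Proof. by rewrite exprZn expr_pow_base. Qed.

Lemma TrD x y : Tr (x + y) = Tr x + Tr y.
Proof. by rewrite -big_split; apply: eq_bigr => i _; apply: exprqkD. Qed.

Lemma TrZ (k : K) x : Tr (k *: x) = k *: Tr x.
Proof. by rewrite scaler_sumr; apply: eq_bigr => i _; apply: exprqkZ. Qed.

Lemma Tr0 : Tr 0 = 0.
Proof. by have := TrZ 0 0; rewrite !scale0r. Qed.

Lemma Tr_sum I (r : seq I) (P : pred I) (f : I -> E) :
  Tr (\sum_(j <- r | P j) f j) = \sum_(j <- r | P j) Tr (f j).
Proof.
exact: (big_morph _ TrD Tr0).
Qed.

(** The Frobenius permutes the summands cyclically, the last one returning to x. *)
Lemma Tr_frob x : Tr (x ^+ (q ^ 2)) = Tr x.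
Proof.
rewrite /Defs.Tr; case: n n0 expr_card_ext => // k _ xk.
rewrite big_ord_recr big_ord_recl /= -exprM -expnD -[(2 + _)%N]/(2 * 1 + _)%N.
rewrite -mulnDr add1n xk addrC muln0 expr1; congr (_ + _); apply: eq_bigr => i _.
by rewrite -exprM -expnD -[(2 + _)%N]/(2 * 1 + _)%N -mulnDr.
Qed.

Lemma Tr_frobk i x : Tr (x ^+ (q ^ (2 * i))) = Tr x.
Proof.
elim: i => [|i IH]; first by rewrite expr1.
by rewrite mulnS addnC expnD exprM Tr_frob.
Qed.

(** The trace read in [K] instead of [E]. The default 0 is never taken: the trace is fixed by the
    q^2-power map, hence lies in the line spanned by 1. *)
Definition trK (x : E) : K := odflt 0 [pick k : K | k%:A == Tr x].

Lemma trKE x : (trK x)%:A = Tr x.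
Proof.
rewrite /trK; case: pickP => [k /eqP //|noK].
have : Tr x ^+ (q ^ 2) = Tr x.
  by rewrite -[RHS]Tr_frob /Defs.Tr exprqk_sum; apply: eq_bigr => i _; rewrite -!exprM mulnC.
move=> fixT; have : (Tr x : W) \in (1%VS : {vspace W}).
  by rewrite Fermat's_little_theorem dimv1 expn1 cK fixT.
by case/vlineP => k xk; have := noK k; rewrite xk eqxx.
Qed.

Lemma in_alg_inj : injective (in_alg E).
Proof. exact: fmorph_inj. Qed.

Lemma card_root_ext (p : {poly E}) :
  p != 0 -> (#|[set x : W | root p (x : E)]| < size p)%N.
Proof. by move=> p0; apply: (@card_root_ltn W p). Qed.

(** Otherwise v z runs through all of [E], and the trace, a nonzero polynomial of degree at most
    q^(2(n-1)), has q^(2n) roots. *)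
Lemma Tr_nondegenerate (z : E) : (forall v, Tr (v * z) = 0) -> z = 0.
Proof.
move=> Tz; apply/eqP; apply: contraT => z0.
pose p : {poly E} := \sum_(i < n) 'X^(q ^ (2 * i)).
have p0 : p != 0.
  apply/eqP => /(congr1 (fun p : {poly E} => p`_1)) /eqP.
  rewrite coef_sum coef0; case: n n0 => // k _.
  rewrite big_ord_recl coefXn eqxx big1 ?addr0 ?oner_eq0 // => i _.
  by rewrite coefXn /= -[X in X == _](expn0 q) eqn_exp2l.
have := card_root_ext p p0.
have -> : #|[set x : W | root p (x : E)]| = #|{: W}|.
  apply: eq_card => x; rewrite !inE rootE horner_sum.
  apply/eqP; transitivity (Tr ((x : E) / z * z)); last exact: Tz.
  by rewrite divfK //; apply: eq_bigr => i _; rewrite hornerXn.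
rewrite card_ext ltnNge => /negP[]; apply: leq_trans (_ : (q ^ (2 * n.-1)).+1 <= _)%N.
  apply: leq_trans (size_sum _ _ _) _; apply/bigmax_leqP => i _.
  by rewrite size_polyXn ltnS leq_exp2l //; have := ltn_ord i; lia.
by rewrite ltn_exp2l //; lia.
Qed.

(** * The adjoint of L and the Hermitian forms H_l *)

Variable a : nat -> E.
Local Notation L := (@Lpol K E q n a).
Local Notation Ls := (@Lstar K E q n a).

Lemma LpolD x y : L (x + y) = L x + L y.
Proof.
by rewrite -big_split; apply: eq_bigr => i _; rewrite exprqkD mulrDr.
Qed.

Lemma LpolZ (k : K) x : L (k *: x) = k *: L x.
Proof.
by rewrite scaler_sumr; apply: eq_bigr => i _; rewrite exprqkZ scalerAr.
Qed.

Lemma LstarD x y : Ls (x + y) = Ls x + Ls y.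
Proof.
by rewrite -big_split; apply: eq_bigr => i _; rewrite mulrDr exprqkD.
Qed.

Lemma LstarZ (k : K) x : Ls (k *: x) = k *: Ls x.
Proof.
by rewrite scaler_sumr; apply: eq_bigr => i _; rewrite -scalerAr exprqkZ.
Qed.

Lemma vLstarLE (v : K) x : vLstarL q n a v x = v *: Ls x + L x.
Proof.
pose f x := v *: Ls x + L x.
have fL : linear f.
  move=> k y z; rewrite /f LstarD LstarZ LpolD LpolZ !scalerDr !scalerA.
  by rewrite [v * k]mulrC addrACA.
(* [lfunE] asks for a bundled linear map; this bundle unfolds to the bare function inside
   [vLstarL]. *)
pose lf : {linear E -> E} := HB.pack f (GRing.isLinear.Build K E E _ f fL).
exact: (lfunE lf x).
Qed.

Lemma Tr_expq x : Tr x ^+ q = Tr (x ^+ q).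
Proof.
by rewrite exprq_sum; apply: eq_bigr => i _; rewrite -!exprM mulnC.
Qed.

(** Raising the i-th summand to the power q^(2(n-i-1)) leaves its trace unchanged. The exponents of
    q on x add up to 1 + 2i + 1 + 2(n-i-1) = 2n, so x itself returns. *)
Lemma Lstar_adjoint x z : Tr (z * L (x ^+ q) ^+ q) = Tr (x * Ls z).
Proof.
rewrite exprq_sum !mulr_sumr !Tr_sum.
apply: eq_bigr => i _; rewrite -(Tr_frobk (n - i - 1)) !exprMn.
have : x ^+ (q ^ 1) ^+ (q ^ (2 * i)) ^+ (q ^ 1) ^+ (q ^ (2 * (n - i - 1))) = x.
  rewrite -!exprM -!expnD -[RHS]expr_card_ext; congr (_ ^+ (q ^ _)).
  by have := ltn_ord i; lia.
by rewrite !expn1 => ->; congr (Tr _); ring.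
Qed.

Definition sesq (x y : E) : K := trK (x * L (y ^+ q)).
Local Notation B := sesq.

Lemma sesqE x y : (B x y)%:A = Tr (x * L (y ^+ q)).
Proof. exact: trKE. Qed.

Definition hform (l : K) (x y : E) : K := l * B x y + (l * B y x) ^+ q.
Local Notation H := hform.

(** The adjunction frees x from under L, so that nondegeneracy of the trace can read off the
    radical. *)
Lemma hformE l x y :
  (H l x y)%:A = Tr (x * (l *: L (y ^+ q) + l ^+ q *: Ls (y ^+ q))).
Proof.
rewrite -[LHS]/(in_alg E (H l x y)) /H rmorphD rmorphXn !rmorphM /= !sesqE.
rewrite exprMn Tr_expq exprMn Lstar_adjoint exprZn expr1n !mulr_algl -!TrZ -TrD.
by rewrite mulrDr !scalerAr.
Qed.

Lemma hformD l x y z : H l (x + y) z = H l x z + H l y z.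
Proof. by apply: in_alg_inj; rewrite [RHS]rmorphD /= !hformE mulrDl TrD. Qed.

Lemma hformZ l k x z : H l (k *: x) z = k * H l x z.
Proof.
by apply: in_alg_inj; rewrite [RHS]rmorphM /= !hformE -scalerAl TrZ mulr_algl.
Qed.

Lemma hformC l x y : H l y x = H l x y ^+ q.
Proof. by rewrite /H exprqD // exprqq // addrC. Qed.

Lemma hform_rad (l : K) (w : E) : l != 0 ->
  (forall v, H l v w = 0) <-> vLstarL q n a (l ^+ q.-1) (w ^+ q) = 0.
Proof.
move=> l0; rewrite vLstarLE.
have e : l *: L (w ^+ q) + l ^+ q *: Ls (w ^+ q) =
    l *: (l ^+ q.-1 *: Ls (w ^+ q) + L (w ^+ q)).
  by rewrite scalerDr scalerA -exprS prednK // addrC.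
split=> [Hw | w0 v].
  apply/eqP; rewrite -(inj_eq (scalerI l0)) -e scaler0; apply/eqP.
  by apply: Tr_nondegenerate => v; rewrite -hformE Hw scale0r.
by apply: in_alg_inj; rewrite /= hformE e w0 scaler0 mulr0 Tr0 scale0r.
Qed.

(** The bijection w -> w^q is only semilinear, so radical and kernel are compared by cardinality. *)
Lemma card_hform_rad (l : K) : l != 0 ->
  #|herm_rad K W (H l)| = (q ^ (2 * \dim (lker (vLstarL q n a (l ^+ q.-1)))))%N.
Proof.
move=> l0; set U := lker _.
rewrite expnM -cK -(@card_vspace K W (Vector.class (W : vectType K)) U).
have inj : injective (fun w : W => (w : E) ^+ q : W).
  move=> x y /(congr1 (fun w : W => (w : E) ^+ (q ^ (2 * n).-1))).
  rewrite /= -!exprM -expnS prednK; last by rewrite muln_gt0.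
  by rewrite !expr_card_ext.
rewrite -[RHS](on_card_preimset (f := fun w : W => (w : E) ^+ q : W)); last first.
  by apply: onW_bij; apply: injF_bij.
apply: eq_card => w; rewrite !inE memv_ker.
apply/forallP/eqP => [Hw|Hw v]; last by rewrite (iffRL (hform_rad l w l0) Hw).
by apply: (iffLR (hform_rad l w l0)) => v; apply/eqP/Hw.
Qed.

Lemma hform_excess (l : K) : l != 0 ->
  let r := (n + \dim (lker (vLstarL q n a (l ^+ q.-1))))%N in
  herm_excess K W (H l) = (-1) ^+ r * (q ^ r)%N%:Z.
Proof.
move=> l0 /=; apply: herm_excessE => //.
- exact: hformD.
- exact: hformZ.
- exact: hformC.
- exact: card_ext.
- exact: card_hform_rad.
Qed.

(** * From the counts N_c to the excesses S_l *)

Lemma NcountE c : Ncount q n a c = #|[set u : W | B u u + c == 0]|.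
Proof.
apply: eq_card => u; rewrite !inE -sesqE -scalerDl.
by rewrite scaler_eq0 oner_eq0 orbF.
Qed.

Local Notation T k := (k + k ^+ q).

(** An indicator of w = 0: all q^2-1 scalars l count when w = 0, only q-1 of them otherwise. *)
Lemma count_trace0 (w : K) :
  \sum_(l : K | l != 0) (T (l * w) == 0)%:R =
  q.-1%:Z + (q%:Z ^+ 2 - q%:Z) * (w == 0)%:R.
Proof.
have [->|w0] := eqVneq w 0.
  rewrite mulr1 (eq_bigr (fun=> 1)); last first.
    by move=> l _; rewrite mulr0 expr0n gtn_eqF // addr0 eqxx.
  rewrite sumr_const (cardC1 (0 : K)) cK natz; nia.
rewrite mulr0 addr0 -(card_trace0 K q cK q1 w w0) -natz -sumr_const.
rewrite [RHS](eq_bigl (fun l => (l != 0) && (T (l * w) == 0))); last by move=> l; rewrite inE.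
by rewrite big_mkcondr; apply: eq_bigr => l _; case: eqP.
Qed.

(** The pairs (l, u) with T(l (B(u,u) + c)) = 0 are counted twice: for fixed u by [count_trace0],
    for fixed l by a level set of H_l. *)
Lemma Ncount_excess c :
  q%:Z ^+ 2 * q.-1%:Z * ((Ncount q n a c)%:Z - (q ^ (2 * (n - 1)))%N%:Z) =
  \sum_(l : K | l != 0)
    herm_excess K W (H l) * (q%:Z * (T (l * c) == 0)%:R - 1).
Proof.
(* Since T(l B(u,u)) = H_l(u,u), the vector u lies in the level -T(l c). The factor q lets
   [card_herm] eliminate Z_1. *)
have count_l (l : K) : l != 0 ->
    q%:Z * \sum_(u : W) (T (l * (B u u + c)) == 0)%:R =
    (q ^ (2 * n))%N%:Z + herm_excess K W (H l) * (q%:Z * (T (l * c) == 0)%:R - 1).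
  move=> l0.
  have sfix : (- T (l * c)) ^+ q = - T (l * c).
    by rewrite exprqN // exprqD // exprqq // addrC.
  have -> : \sum_(u : W) (T (l * (B u u + c)) == 0)%:R =
      (herm_count K W (H l) (- T (l * c)))%:Z :> int.
    rewrite -natr_sum natz /herm_count -sum1dep_card; congr Posz.
    rewrite -big_mkcond /=; apply: eq_bigl => u.
    rewrite -addr_eq0; congr (_ == 0).
    by rewrite /H mulrDr exprqD //; ring.
  rewrite (herm_countE K q cK q1) //; first last.
  - exact: hformC.
  - exact: hformZ.
  rewrite oppr_eq0 -card_ext (card_herm K q cK q1 W (H l)) //; first last.
  - exact: hformC.
  - exact: hformZ.
  ring.
rewrite (eq_bigr (fun l => q%:Z * (\sum_(u : W) (T (l * (B u u + c)) == 0)%:R) -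
    (q ^ (2 * n))%N%:Z)); last first.
  by move=> l l0; rewrite count_l // addrAC subrr add0r.
rewrite sumrB -mulr_sumr exchange_big /= (eq_bigr _ (fun u _ => count_trace0 (B u u + c))).
rewrite big_split /= -mulr_sumr sumr_const (cardC1 (0 : K)) cK NcountE.
have -> : \sum_(u : W) q.-1%:Z = q.-1%:Z * (q ^ (2 * n))%N%:Z.
  by rewrite sumr_const card_ext -mulr_natr natz.
have -> : \sum_(u : W) (B u u + c == 0)%:R = #|[set u : W | B u u + c == 0]|%:Z.
  by rewrite -natr_sum natz -sum1dep_card -big_mkcond.
have -> : (q ^ (2 * n))%N%:Z = q%:Z ^+ 2 * (q ^ (2 * (n - 1)))%N%:Z.
  by rewrite -[q%:Z ^+ 2]/(q * q)%N%:Z mulnn -PoszM -expnD; congr (q ^ _)%N%:Z; lia.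
rewrite -mulr_natr natz.
have -> : (q ^ 2).-1%:Z = q%:Z ^+ 2 - 1 by rewrite -mulnn -subn1 -subzn ?muln_gt0 ?q0.
have -> : q.-1%:Z = q%:Z - 1 by rewrite -subn1 -subzn.
move: (q ^ _)%N => Q; ring.
Qed.

(** * Values of D when every kernel has dimension 2m+1 *)

Variable m : nat.

Local Notation D c := ((Ncount q n a c)%:Z - (q ^ (2 * (n - 1)))%N%:Z).
Local Notation d l := (\dim (lker (vLstarL q n a (l ^+ q.-1)))).
Local Notation S l := (herm_excess K W (H l)).
Local Notation eps l c := (q%:Z * (T (l * c) == 0)%:R - 1).
(** The largest possible |S_l|, reached when d_l = 2m+1. *)
Local Notation M := ((q ^ (n + (2 * m + 1)))%N%:Z).

Local Notation bound := (((q ^ 2 - 1) * q ^ (n + 2 * m - 1))%N%:Z).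

Lemma sum_nonzero_const (x : int) :
  \sum_(l : K | l != 0) x = (q%:Z ^+ 2 - 1) * x.
Proof.
rewrite sumr_const (cardC1 (0 : K)) cK -mulr_natl natz; congr (_ * _).
by rewrite -mulnn -subn1 -subzn ?muln_gt0 ?q0.
Qed.

(** All S_l are equal, so only the sum of the weights depends on c: it is (q-1)(q^2-1) for c = 0 and
    q(q-1) - (q^2-1) = -(q-1) otherwise. *)
Lemma Ncount_const c : (forall l : K, l != 0 -> d l = (2 * m + 1)%N) ->
  q%:Z ^+ 2 * (q%:Z - 1) * D c =
  (-1) ^+ (n - 1) * M * ((q%:Z - 1) * (if c == 0 then q%:Z ^+ 2 - 1 else -1)).
Proof.
move=> dl; have qm : q.-1%:Z = q%:Z - 1 by rewrite -subn1 -subzn.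
rewrite -qm Ncount_excess.
have sgn : (-1) ^+ (n + (2 * m + 1)) = (-1) ^+ (n - 1) :> int.
  have -> : (n + (2 * m + 1) = n - 1 + 2 * m.+1)%N by lia.
  by rewrite exprD exprM sqrrN expr1n mulr1.
rewrite (eq_bigr (fun l => (-1) ^+ (n - 1) * M * eps l c)); last first.
  by move=> l l0; rewrite hform_excess // dl // sgn.
rewrite -mulr_sumr sumrB -mulr_sumr count_trace0 sum_nonzero_const qm; congr (_ * _).
by case: eqP => _ /=; ring.
Qed.

Lemma M_bound : (q%:Z ^+ 2 - 1) * M =
  q%:Z ^+ 2 * ((q ^ 2 - 1) * q ^ (n + 2 * m - 1))%N%:Z.
Proof.
have -> : (n + (2 * m + 1) = 2 + (n + 2 * m - 1))%N by lia.
rewrite expnD !PoszM -subzn ?expn_gt0 ?q0 // -mulnn PoszM; ring.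
Qed.

Lemma Ncount0 : (forall l : K, l != 0 -> d l = (2 * m + 1)%N) ->
  D 0 = (-1) ^+ (n - 1) * bound.
Proof.
move=> dl; have := Ncount_const 0 dl; rewrite eqxx => e.
have X0 : q%:Z ^+ 2 * (q%:Z - 1) != 0 by rewrite mulf_neq0 ?expf_neq0 //; lia.
apply: (mulfI X0); rewrite e [(q%:Z - 1) * _]mulrC mulrA
  -[_ * M * _]mulrA [M * _]mulrC M_bound.
ring.
Qed.

(** Here |D c| is smaller than the bound by the factor q^2-1; equality would force q^2-1 = 1. *)
Lemma Ncount_neq0 c : (forall l : K, l != 0 -> d l = (2 * m + 1)%N) ->
  c != 0 -> `|D c| != bound.
Proof.
move=> dl c0; apply/eqP => De; have := Ncount_const c dl; rewrite (negPf c0) => e.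
have X0 : 0 < q%:Z - 1 by lia.
have M0 : 0 < M by rewrite ltz_nat expn_gt0 q0.
have q20 : 0 < q%:Z ^+ 2 by rewrite exprn_gt0 // ltz_nat.
have : q%:Z ^+ 2 * (q%:Z - 1) * bound = M * (q%:Z - 1).
  rewrite -De -[_ * (_ - 1) in LHS]ger0_norm ?mulr_ge0 ?ltW // -normrM e normrM.
  by rewrite [X in X * _]normrM normr_sign mul1r mulrN1 normrN !gtr0_norm.
rewrite mulrAC -M_bound [_ * M]mulrC => /(mulIf (lt0r_neq0 X0)).
rewrite -[RHS]mulr1 => /(mulfI (lt0r_neq0 M0)).
by nia.
Qed.

(** * Kernel dimensions, the bound and the case of equality *)

Hypotheses (mn : (m < n)%N) (am : a m != 0)
  (aH : forall i : nat, (m < i < n)%N -> a i = 0).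

Lemma sum_trunc (F : nat -> E) : (forall i, (m < i < n)%N -> F i = 0) ->
  \sum_(i < n) F i = \sum_(i < m.+1) F i.
Proof.
move=> F0; rewrite [RHS](big_ord_widen _ F mn) [LHS](bigID (fun i : 'I_n => (i < m.+1)%N)) /=.
rewrite [X in _ + X]big1 ?addr0 // => i.
by rewrite -leqNgt => mi; apply: F0; rewrite mi ltn_ord.
Qed.

(* Raising an element of the kernel to the power q^(2(m+1)) lowers the exponents
   of L^* modulo x^(q^(2n)) = x to q^(2j), j <= m, and raises those of L to
   q^(2j), m < j <= 2m+1: a nonzero polynomial of degree q^(2(2m+1)). *)
Lemma dim_lker_vLstarL (v : K) : (\dim (lker (vLstarL q n a v)) <= 2 * m + 1)%N.
Proof.
pose e i := (q ^ (2 * i))%N.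
pose p : {poly E} := \sum_(i < m.+1)
  ((v *: (a i ^+ q ^+ e (n - i - 1)%N ^+ e m.+1)) *: 'X^(e (m - i)%N)
    + (a i ^+ e m.+1) *: 'X^(e (i + m.+1)%N)).
have size_p : (size p <= (e (2 * m + 1)%N).+1)%N.
  apply: leq_trans (size_sum _ _ _) _; apply/bigmax_leqP => i _.
  apply: leq_trans (size_polyD _ _) _; rewrite geq_max.
  apply/andP; split; apply: leq_trans (size_scale_leq _ _) _;
    rewrite size_polyXn ltnS leq_exp2l //; have := ltn_ord i; lia.
have p0 : p != 0.
  (* Only the summand of L with i = m reaches this exponent; its coefficient is a power of [a m]. *)
  apply/eqP => /(congr1 (fun p : {poly E} => p`_(e (2 * m + 1)%N))) /eqP.
  have e_inj i j : (e i == e j) = (i == j) by rewrite eqn_exp2l // eqn_pmul2l.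
  have low i : (2 * m + 1 == m - i)%N = false by apply/eqP; lia.
  have high i : (2 * m + 1 == i + m.+1)%N = (i == m) by apply/eqP/eqP; lia.
  rewrite coef_sum coef0 big_ord_recr big1 /= => [|i _].
    rewrite coefD !coefZ !coefXn !e_inj low high eqxx mulr0 mulr1 !add0r.
    by rewrite expf_eq0 (negPf am) andbF.
  by rewrite coefD !coefZ !coefXn !e_inj low high ltn_eqF // !mulr0 addr0.
set U := lker _.
have ltU : (#|(U : {vspace W})| < size p)%N.
  apply: leq_ltn_trans (card_root_ext p p0).
  apply: subset_leq_card; apply/subsetP => x.
  rewrite inE memv_ker vLstarLE => /eqP kx; apply/eqP.
  transitivity ((v *: Ls x + L x) ^+ e m.+1); last first.
    by rewrite kx expr0n gtn_eqF // expn_gt0 q0.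
  have -> : Ls x = \sum_(i < m.+1) (a i ^+ q * x) ^+ e (n - i - 1)%N.
    apply: (sum_trunc (fun i => (a i ^+ q * x) ^+ e (n - i - 1)%N)) => i mi.
    by rewrite aH // expr0n gtn_eqF // mul0r expr0n gtn_eqF // expn_gt0 q0.
  have -> : L x = \sum_(i < m.+1) a i * x ^+ e i.
    by apply: (sum_trunc (fun i => a i * x ^+ e i)) => i mi; rewrite aH // mul0r.
  rewrite exprqkD exprqkZ !exprqk_sum scaler_sumr -big_split /= horner_sum.
  apply: eq_bigr => i _; rewrite hornerD !hornerZ !hornerXn !exprMn -!exprM -!expnD.
  rewrite -!mulnDr -!scalerAl; congr (_ *: (_ * _) + _ * _).
  have -> : (n - i - 1 + m.+1 = n + (m - i))%N by have := ltn_ord i; lia.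
  by rewrite mulnDr expnD exprM expr_card_ext.
move: ltU; rewrite (@card_vspace K W (Vector.class (W : vectType K)) U) cK -expnM.
by move=> /leq_trans /(_ size_p); rewrite ltnS leq_exp2l // leq_mul2l.
Qed.

Lemma norm_hform_excess (l : K) : l != 0 -> `|S l| = (q ^ (n + d l))%N%:Z.
Proof. by move=> l0; rewrite hform_excess // normrM normr_sign mul1r. Qed.

Lemma norm_term_le (l c : K) : l != 0 -> `|S l * eps l c| <= M * (q%:Z - 1).
Proof.
move=> l0; rewrite normrM norm_hform_excess //; apply: ler_pM => //.
  by rewrite lez_nat leq_exp2l // leq_add2l dim_lker_vLstarL.
by case: eqP => _ /=; rewrite ?mulr1 ?mulr0; lia.
Qed.

(** A smaller kernel makes |S_l| < M, and the weight, at most q-1 in absolute value, cannot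
    compensate. *)
Lemma norm_term_max (l c : K) : l != 0 -> `|S l * eps l c| = M * (q%:Z - 1) ->
  d l = (2 * m + 1)%N.
Proof.
move=> l0; rewrite normrM norm_hform_excess // => e.
apply/eqP; rewrite eqn_leq dim_lker_vLstarL leqNgt; apply/negP => lt.
have : ((q ^ (n + d l))%N%:Z < M) by rewrite ltz_nat ltn_exp2l // ltn_add2l.
have : `|eps l c| <= q%:Z - 1 by case: eqP => _ /=; rewrite ?mulr1 ?mulr0; lia.
move=> eps_le ltM; have : (q ^ (n + d l))%N%:Z * `|eps l c| < M * (q%:Z - 1).
  apply: le_lt_trans (ler_wpM2l _ eps_le) _ => //.
  by rewrite ltr_pM2r // subr_gt0 ltz_nat.
by rewrite e ltxx.
Qed.

Lemma norm_sum_terms c :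
  q%:Z ^+ 2 * (q%:Z - 1) * `|D c| <= \sum_(l : K | l != 0) `|S l * eps l c|.
Proof.
have qm : q.-1%:Z = q%:Z - 1 by rewrite -subn1 -subzn.
have -> : q%:Z ^+ 2 * (q%:Z - 1) * `|D c| = `|q%:Z ^+ 2 * q.-1%:Z * D c|.
  by rewrite [RHS]normrM qm [X in _ = X * _]ger0_norm //; nia.
by rewrite Ncount_excess ler_norm_sum.
Qed.

Lemma Ncount_bound c : `|D c| <= bound.
Proof.
have le : \sum_(l : K | l != 0) `|S l * eps l c| <= (q%:Z ^+ 2 - 1) * (M * (q%:Z - 1)).
  by rewrite -sum_nonzero_const; apply: ler_sum => l l0; apply: norm_term_le.
have := le_trans (norm_sum_terms c) le.
have -> : (q%:Z ^+ 2 - 1) * (M * (q%:Z - 1)) = q%:Z ^+ 2 * (q%:Z - 1) * bound.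
  by rewrite mulrA M_bound mulrAC.
by rewrite ler_pM2l // mulr_gt0 ?exprn_gt0 ?ltz_nat // subr_gt0 ltz_nat.
Qed.

(** The nonnegative gaps sum to zero, so each vanishes. For q = 2 both weights have absolute value
    1, so termwise equality does not give c = 0; that comes from [Ncount_neq0]. *)
Lemma Ncount_extremal c : `|D c| = bound ->
  forall l : K, l != 0 -> d l = (2 * m + 1)%N.
Proof.
move=> De; have ge := norm_sum_terms c; rewrite De in ge.
have sum0 : \sum_(l : K | l != 0) (M * (q%:Z - 1) - `|S l * eps l c|) = 0.
  apply/eqP; rewrite eq_le sumr_ge0; last first.
    by move=> l l0; rewrite subr_ge0 norm_term_le.
  rewrite andbT sumrB sum_nonzero_const subr_le0 (le_trans _ ge) //.
  by rewrite mulrA M_bound mulrAC.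
have ge0 l : l != 0 -> 0 <= M * (q%:Z - 1) - `|S l * eps l c|.
  by move=> l0; rewrite subr_ge0 norm_term_le.
move=> l l0; apply: (norm_term_max l c l0); apply/eqP; rewrite eq_sym -subr_eq0.
by apply/eqP; apply: (psumr_eq0P ge0 sum0).
Qed.

End TraceForm.

Theorem theorem4p3 (q n m : nat) (F0 : finFieldType) (E : fieldExtType F0)
  (a : nat -> E) :
  prime_power q -> (0 < n)%N ->
  #|F0| = (q ^ 2)%N -> \dim {:E} = n ->
  (* L has degree q^(2m) *)
  (m < n)%N -> a m != 0 -> (forall i : nat, (m < i < n)%N -> a i = 0) ->
  let bound : int := ((q ^ 2 - 1) * q ^ (n + 2 * m - 1))%N%:Z in
  let D (c : F0) : int := (Ncount q n a c)%:Z - (q ^ (2 * (n - 1)))%N%:Z in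
  (forall c : F0, `|D c| <= bound) /\
  (forall c : F0, `|D c| = bound <->
     (c = 0 /\ forall v : F0, inU q v -> \dim (lker (vLstarL q n a v)) = (2 * m + 1)%N)) /\
  ((forall v : F0, inU q v -> \dim (lker (vLstarL q n a v)) = (2 * m + 1)%N) ->
     D 0 = (-1) ^+ (n - 1) * bound).
Proof.
case=> p [k [pr_p [k0 qE]]] n0 cK dimE mn am aH bound D.
have q1 : (1 < q)%N by rewrite qE -(expn0 p) ltn_exp2l // prime_gt1.
(* The field has p^(2k) elements, so q is a power of its characteristic and the q-power map is
   additive. *)
have pcharq : [pchar F0].-nat q.
  rewrite qE pnatX pnatE //; apply/orP; left.
  by apply: (@card_finPcharP _ p (k * 2)) => //; rewrite cK qE expnM.
have U_d := unitary_forall F0 q cK q1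
  (fun v => \dim (lker (vLstarL q n a v)) = (2 * m + 1)%N).
have D0 : (forall v : F0, inU q v -> \dim (lker (vLstarL q n a v)) = (2 * m + 1)%N) ->
    D 0 = (-1) ^+ (n - 1) * bound.
  by move=> /U_d; apply: (Ncount0 F0 q n E cK q1 pcharq dimE n0 a m).
split; last split=> //.
  exact: (Ncount_bound F0 q n E cK q1 pcharq dimE n0 a m mn am aH).
move=> c; split=> [De | [-> /D0 ->]]; last by rewrite normrM normr_sign mul1r.
have dl := Ncount_extremal F0 q n E cK q1 pcharq dimE n0 a m mn am aH c De.
split; last exact/U_d.
apply: contraTeq (introT eqP De).
exact: (Ncount_neq0 F0 q n E cK q1 pcharq dimE n0 a m c dl).
Qed.
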